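(* Let $S$ be a rooted plane tree with $m\ge 1$ vertices and degree distribution sequence $d_S=(l,u,d_2,\dots,d_{m-1})$. Let $A_S(z)=\sum_{n\ge 0} a_{\mathcal{B}_n}(S)\,z^n$, where $a_{\mathcal{B}_n}(S)$ is the total number of (plane) embeddings of $S$ into all trees of $\mathcal{B}_n$. Then $$A_S(z)=\left(\frac{1}{1-2zB(z)}\right)^{m+l-1} z^{l+u-1}\, B(z)^{l+u}\, 2^u \prod_{i=3}^{m-1}(\boldsymbol{C}_{i-1})^{d_i},$$ where $B(z)=\frac{1-\sqrt{1-4z^2}}{2z}=\sum_{k\ge0}\boldsymbol{C}_k z^{2k+1}$ is the generating function of plane binary trees (by number of nodes).
   Context: $\mathcal{B}_n$ is the set of plane (ordered) binary trees with $n$ nodes, where every node has either $0$ or $2$ children and the left-to-right order of children matters; edges are directed from parent to child. $\boldsymbol{C}_k=\frac{1}{k+1}\binom{2k}{k}$ is the $k$-th Catalan number. For a rooted tree $S$ with $m$ vertices, its degree distribution sequence is $(d_0,d_1,\dots,d_{m-1})$ where $d_i$ is the number of vertices of out-degree (number of children) $i$; $l=d_0$ is the number of leaves and $u=d_1$ the number of unary vertices. A rooted tree $T$ is viewed as a poset on its vertices in which $v\le w$ iff $w$ is an ancestor of $v$ or $w=v$ (the root is the unique maximal element). For incomparable vertices $x,y$ of a plane tree, $x$ is left of $y$ if, at their lowest common ancestor, the child whose subtree contains $x$ precedes the child whose subtree contains $y$. A (plane) embedding of a plane rooted tree $S$ into a plane rooted tree $T$ is a subset $E$ of vertices of $T$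 such that the induced subposet on $E$ is isomorphic to the poset of $S$ via an isomorphism that respects the left-to-right order of the children of each vertex of $S$. $a_T(S)$ denotes the number of embeddings of $S$ into $T$, and for a finite family $\mathcal{F}$, $a_{\mathcal{F}}(S)=\sum_{T\in\mathcal{F}}a_T(S)$. *)

(* Defs.v *)
From mathcomp Require Import all_boot.
From Stdlib Require List.
Set Implicit Arguments. Unset Strict Implicit. Unset Printing Implicit Defensive.

Inductive tree : Type := Node of seq tree.

(* Vertices of a tree, as addresses: the root is [::], and the k-th child
   (0-based, left to right) of the vertex with address p has address
   p ++ [:: k].  Listed without duplicates. *)
Fixpoint verts (t : tree) : seq (seq nat) :=
  let: Node ts := t in
  [::] :: (fix aux (i : nat) (ts : seq tree) : seq (seq nat) :=
             match ts with
             | [::] => [::]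
             | t1 :: ts' => [seq i :: p | p <- verts t1] ++ aux i.+1 ts'
             end) 0 ts.

Definition nverts (t : tree) : nat := size (verts t).

Definition outdeg (t : tree) (v : seq nat) : nat :=
  count (fun w => (size w == (size v).+1) && prefix v w) (verts t).

Definition degcount (t : tree) (i : nat) : nat :=
  count (fun v => outdeg t v == i) (verts t).

Fixpoint is_binary (t : tree) : bool :=
  let: Node ts := t in
  ((size ts == 0) || (size ts == 2)) &&
  (fix aux (ts : seq tree) : bool :=
     match ts with [::] => true | t1 :: ts' => is_binary t1 && aux ts' end) ts.

Definition vle (v w : seq nat) : bool := prefix w v.

(* x is left of y: at the lowest common ancestor, the child containing x
   precedes the child containing y (meaningful for incomparable x, y). *)
Fixpoint leftof (x y : seq nat) : bool :=
  match x, y with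
  | a :: x', b :: y' => (a < b) || ((a == b) && leftof x' y')
  | _, _ => false
  end.

Definition sib_lt (v w : seq nat) : bool :=
  [&& 0 < size v, size v == size w,
      belast 0 v == belast 0 w & last 0 v < last 0 w].

(* p lists the images of the vertices of S (in the order of verts S);
   it is an order isomorphism onto its image that respects the
   left-to-right order of the children of every vertex of S. *)
Definition good_map (S : tree) (p : seq (seq nat)) : bool :=
  let vs := verts S in
  (size p == size vs) &&
  all (fun i => all (fun j =>
        (vle (nth [::] vs i) (nth [::] vs j) == vle (nth [::] p i) (nth [::] p j))
        && (sib_lt (nth [::] vs i) (nth [::] vs j) ==>
              leftof (nth [::] p i) (nth [::] p j)))
      (iota 0 (size vs))) (iota 0 (size vs)).

(* E (a duplicate-free list of vertices of T) is an embedding of S *)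
Definition is_embedding (S : tree) (E : seq (seq nat)) : bool :=
  has (good_map S) (permutations E).

Fixpoint bitseqs (k : nat) : seq bitseq :=
  if k is k'.+1 then [seq b :: s | b <- [:: true; false], s <- bitseqs k']
  else [:: [::]].

Definition a_T (T S : tree) : nat :=
  count (fun m => is_embedding S (mask m (verts T))) (bitseqs (nverts T)).

Definition series := nat -> nat.
Definition sone : series := fun n => (n == 0).
Definition sX : series := fun n => (n == 1).
Definition sscale (c : nat) (F : series) : series := fun n => c * F n.
Definition smul (F G : series) : series :=
  fun n => \sum_(i < n.+1) F i * G (n - i).
Definition spow (F : series) (k : nat) : series := iter k (smul F) sone.
(* 1/(1 - F) = sum_j F^j, for F with zero constant term (F^j has order >= j) *)
Definition sgeom (F : series) : series :=
  fun n => \sum_(j < n.+1) spow F j n.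

Definition catalan (k : nat) : nat := 'C(k.*2, k) %/ k.+1.

Definition Bser : series := fun n => if odd n then catalan n./2 else 0.

Definition rhs (S : tree) : series :=
  let m := nverts S in
  let l := degcount S 0 in
  let u := degcount S 1 in
  sscale (2 ^ u * \prod_(3 <= i < m) catalan i.-1 ^ degcount S i)
    (smul (spow (sgeom (sscale 2 (smul sX Bser))) (m + l - 1))
      (smul (spow sX (l + u - 1)) (spow Bser (l + u)))).

(* Main.v *)
(** Splitting a binary tree at its root splits an embedded plane forest between
    the two subtrees, unless the forest is a single tree whose root is mapped to
    the root.  Let A(f) be the generating function of the embeddings of a forest
    f into binary trees, and B that of binary trees.  The splits that leave one
    subtree without image contribute 2zB A(f), so solving for A(f) yields a
    factor D = 1/(1 - 2zB).  For forests of at least two trees the other splits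
    are governed by the Catalan recurrence, whence
      A(t_1 ... t_k) = C_(k-1) (zD)^(k-1) A(t_1) ... A(t_k).
    Mapping the root of S to the root of the binary tree then leaves the forest
    of the children of S, and an induction on S collects one factor per vertex.
    The addresses in [verts T] are sorted in preorder and embeddings respect
    preorder, so an image set determines its embedding. *)

From HB Require Import structures.
Require Import Defs.
From mathcomp Require Import all_boot.
From mathcomp Require ssralg poly.
From mathcomp Require Import zify.
From Stdlib Require List.
From Stdlib Require Import FunctionalExtensionality Ring.
Set Implicit Arguments. Unset Strict Implicit. Unset Printing Implicit Defensive.

(** * Embeddings of forests *)

Lemma tree_eq_comparable : comparable tree.
Proof.
rewrite /comparable; fix IH 1; move=> [s] [s'].
by case: (List.list_eq_dec IH s s') => [->|ne]; [left | right => -[]].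
Qed.

HB.instance Definition _ := hasDecEq.Build tree (compareP tree_eq_comparable).

(** The induction principle generated for the nested type [tree] has no hypothesis on the children;
    the inner list induction supplies it. *)
Lemma tree_children_ind (Q : tree -> Prop) :
  (forall ts : seq tree, (forall t, t \in ts -> Q t) -> Q (Node ts)) -> forall t, Q t.
Proof.
move=> QN; fix IH 1; case=> ts; apply: QN; elim: ts => [|t ts IHts] t'.
  by move=> t'_in; exfalso; move: t'_in; rewrite in_nil.
by rewrite inE; case/predU1P => [->|/IHts]; first exact: IH.
Qed.

(* The local fixpoint of [verts]: [i] is the rank of the first tree of [ts]. *)
Fixpoint fverts (i : nat) (ts : seq tree) : seq (seq nat) :=
  if ts is t :: ts' then map (cons i) (verts t) ++ fverts i.+1 ts' else [::].

Lemma vertsE ts : verts (Node ts) = [::] :: fverts 0 ts.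
Proof. by []. Qed.

Lemma nverts_gt0 t : 0 < nverts t.
Proof. by case: t => ts; rewrite /nverts vertsE. Qed.

Lemma size_fverts i ts : size (fverts i ts) = \sum_(t <- ts) nverts t.
Proof.
by elim: ts i => [|t ts IH] i /=; rewrite ?big_nil // big_cons size_cat size_map IH.
Qed.

Lemma nvertsE ts : nverts (Node ts) = (\sum_(t <- ts) nverts t).+1.
Proof. by rewrite /nverts vertsE /= size_fverts. Qed.

Definition anc_eq (a b : seq nat * seq nat) : bool :=
  prefix a.1 b.1 == prefix a.2 b.2.

(* Both lists are meant to be in preorder, where a later vertex is never an
   ancestor of an earlier one; [pairwise] only compares in that order. *)
Definition emb (vs E : seq (seq nat)) : bool :=
  (size E == size vs) && pairwise anc_eq (zip vs E).

Lemma map_zip2 (A B C D : Type) (f : A -> C) (g : B -> D) s t :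
  zip (map f s) (map g t) = [seq (f p.1, g p.2) | p <- zip s t].
Proof. by elim: s t => [|x s IH] [|y t] //=; rewrite IH. Qed.

Lemma emb_mapl c vs E : emb (map (cons c) vs) E = emb vs E.
Proof.
rewrite /emb size_map -[E in zip (map _ _) E]map_id map_zip2 pairwise_map.
congr (_ && _); apply: eq_pairwise => -[v x] [w y].
by rewrite /anc_eq /= eqxx.
Qed.

Lemma emb_mapr c vs E : emb vs (map (cons c) E) = emb vs E.
Proof.
rewrite /emb size_map -[vs in zip vs (map _ _)]map_id map_zip2 pairwise_map.
congr (_ && _); apply: eq_pairwise => -[v x] [w y].
by rewrite /anc_eq /= eqxx.
Qed.

Lemma emb_fverts i ts E : emb (fverts i.+1 ts) E = emb (fverts i ts) E.
Proof.
have shift : fverts i.+1 ts =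
    map (fun v => if v is a :: v' then a.+1 :: v' else [::]) (fverts i ts).
  elim: ts i => [|t ts IH] i //=; rewrite map_cat -map_comp -IH.
  by congr (_ ++ _); apply: eq_map.
have nonil : all (fun v => v != [::]) (fverts i ts).
  elim: ts i {shift} => [|t ts IH] i //=; rewrite all_cat all_map IH andbT.
  exact/allP.
rewrite /emb shift size_map -[E in zip (map _ _) E]map_id map_zip2 pairwise_map.
have [sE|//] := eqVneq (size E) _; rewrite /=.
apply: (@eq_in_pairwise _ (fun a => a.1 != [::])) => [[[|a v] x] [[|b w] y]|].
- by [].
- by [].
- by [].
- by rewrite /anc_eq /=.
by rewrite -(all_map fst (fun v => v != [::])) -/unzip1 unzip1_zip ?sE.
Qed.

Lemma emb_node ts E :
  emb (verts (Node ts)) E =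
  if E is e :: E' then all (prefix e) E' && emb (fverts 0 ts) E' else false.
Proof.
rewrite vertsE; case: E => [|e E] //; rewrite /emb /= eqSS.
have [sE|] := eqVneq (size E) _; last by rewrite andbF.
rewrite /= -[in all _ E](unzip2_zip (s := fverts 0 ts) (t := E)) ?sE //.
rewrite all_map; congr (_ && _); apply: eq_all => -[v x] /=.
by rewrite /anc_eq /= prefix0s eq_sym eqb_id.
Qed.

(** Distinct trees of a forest are incomparable, so across them only the images have to be
    tested. *)
Lemma allrel_zip_fverts i vs ts (E1 E2 : seq (seq nat)) :
  size E1 = size vs -> size E2 = size (fverts i.+1 ts) ->
  allrel anc_eq (zip (map (cons i) vs) E1) (zip (fverts i.+1 ts) E2) =
  allrel (fun x y => ~~ prefix x y) E1 E2.
Proof.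
move=> s1 s2.
have far : all (fun w => i < head 0 w) (fverts i.+1 ts).
  (* The selective generalization lets the starting rank range over all [j > i] while [i] stays
     fixed. *)
  move: (leqnn i.+1); rewrite {1}/is_true.
  elim: ts {2 4}i.+1 {s2} => [|t ts IH] j ij //=.
  rewrite all_cat all_map IH ?(leqW ij) // andbT.
  exact/allP.
rewrite -[E1 in RHS](unzip2_zip (s := map (cons i) vs)) ?size_map ?s1 //.
rewrite -[E2 in RHS](unzip2_zip (s := fverts i.+1 ts)) ?s2 //.
rewrite allrel_mapl allrel_mapr.
apply: (@eq_in_allrel _ _ (fun a => ohead a.1 == Some i) (fun a => i < head 0 a.1)).
- case=> [[|a v] x] [[|b w] y] //= /eqP[->] ltib.
  by rewrite /anc_eq /= ltn_eqF //; case: prefix.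
- rewrite -(all_map fst (fun v => ohead v == Some i)) -/unzip1 unzip1_zip.
    by rewrite all_map; apply/allP => v _ /=.
  by rewrite size_map s1.
- by rewrite -(all_map fst (fun v => i < head 0 v)) -/unzip1 unzip1_zip ?s2.
Qed.

Lemma emb_cons i t ts E :
  emb (fverts i (t :: ts)) E =
  [&& emb (verts t) (take (nverts t) E), emb (fverts i ts) (drop (nverts t) E)
    & allrel (fun x y => ~~ prefix x y) (take (nverts t) E) (drop (nverts t) E)].
Proof.
rewrite -[emb (verts t) _](emb_mapl i) -[emb (fverts i ts) _]emb_fverts /=.
rewrite /emb size_cat size_map size_take_min size_drop.
have [sE|nsE] := eqVneq (size E) _; last first.
  apply/esym/negP => /and3P[/andP[/eqP s1 _] /andP[/eqP s2 _] _].
  by move: nsE; rewrite -s1 -s2 /nverts; lia.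
have -> : minn (nverts t) (size E) = size (verts t) by rewrite sE /nverts; lia.
have -> : size E - nverts t = size (fverts i.+1 ts) by rewrite sE /nverts; lia.
rewrite !eqxx /= -{1}(cat_take_drop (nverts t) E) zip_cat; last first.
  by rewrite size_map size_take_min sE /nverts; lia.
rewrite pairwise_cat allrel_zip_fverts.
- by rewrite andbC -andbA.
- by rewrite size_take_min sE /nverts; lia.
by rewrite size_drop sE /nverts; lia.
Qed.

Lemma emb_nil E : emb [::] E = nilp E.
Proof. by rewrite /emb; case: E. Qed.

Lemma emb_singl t E : emb (fverts 0 [:: t]) E = emb (verts t) E.
Proof. by rewrite /= cats0 emb_mapl. Qed.

Lemma emb_size vs E : emb vs E -> size E = size vs.
Proof. by case/andP => /eqP. Qed.

(** An embedded tree cannot meet both subtrees: the image of its root comes first, hence in the left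
    one, and would have to be an ancestor of [1 :: x]. *)
Lemma emb_straddle t e E1 x E2 : ~~ emb (verts t) ((0 :: e) :: E1 ++ (1 :: x) :: E2).
Proof. by case: t => ts; rewrite emb_node all_cat /= andbF. Qed.

(** Each tree lies within one subtree, and by preorder those on the left come first; [j] is their
    number. Every tree has a vertex, so the size of [E1] admits at most one [j], and the sum is
    again a truth value. *)
Lemma emb_branch fs E1 E2 :
  emb (fverts 0 fs) (map (cons 0) E1 ++ map (cons 1) E2) =
  \sum_(j < (size fs).+1) emb (fverts 0 (take j fs)) E1 * emb (fverts 0 (drop j fs)) E2
    :> nat.
Proof.
elim: fs E1 => [|t ts IH] E1.
  rewrite big_ord_recl big_ord0 addn0 /= !emb_nil /nilp size_cat !size_map addn_eq0.
  by rewrite mulnb.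
rewrite big_ord_recl /= emb_nil.
(* If [E1] has room for [t], the term [j = 0] vanishes and [t] goes left. *)
case: (leqP (nverts t) (size E1)) => [leE|ltE].
  have -> : nilp E1 = false by move: leE (nverts_gt0 t); rewrite /nilp; lia.
  rewrite mul0n add0n emb_cons take_cat drop_cat size_map.
  have tk : (if nverts t < size E1 then take (nverts t) (map (cons 0) E1)
     else map (cons 0) E1 ++ take (nverts t - size E1) (map (cons 1) E2))
     = map (cons 0) (take (nverts t) E1).
    case: ltnP => [_|geE]; first by rewrite map_take.
    have -> : nverts t - size E1 = 0 by lia.
    by rewrite take0 cats0 take_oversize.
  have dr : (if nverts t < size E1 then drop (nverts t) (map (cons 0) E1) ++ map (cons 1) E2
     else drop (nverts t - size E1) (map (cons 1) E2))
     = map (cons 0) (drop (nverts t) E1) ++ map (cons 1) E2.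
    case: ltnP => [_|geE]; first by rewrite map_drop.
    have -> : nverts t - size E1 = 0 by lia.
    by rewrite drop0 drop_oversize.
  rewrite tk dr emb_mapr allrel_catr !allrel_mapl !allrel_mapr.
  under eq_bigr => j _ do rewrite /= emb_cons.
  have -> : allrel (fun a b => ~~ prefix (0 :: a) (1 :: b)) (take (nverts t) E1) E2.
    by apply/allrelP.
  have -> : allrel (fun a b => ~~ prefix (0 :: a) (0 :: b))
      (take (nverts t) E1) (drop (nverts t) E1)
     = allrel (fun x y => ~~ prefix x y) (take (nverts t) E1) (drop (nverts t) E1).
    by apply: eq_allrel => a b.
  case: (emb (verts t) _) => /=; last by rewrite big1.
  case: allrel; last by rewrite andbF big1 // => j _; rewrite andbF.
  by rewrite !andbT IH; apply: eq_bigr => j _; rewrite andbT.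
(* Otherwise the terms with [j > 0] vanish, since they place [t] in [E1]. *)
rewrite [X in _ = _ + X]big1 ?addn0 => [|j _]; last first.
  rewrite /= emb_cons; case H: (emb (verts t) _) => //.
  by move: (emb_size H) (ltE); rewrite take_oversize ?(ltnW ltE) // /nverts => ->; rewrite ltnn.
case: E1 ltE => [|e E1] ltE; first by rewrite mul1n /= emb_mapr.
(* A nonempty [E1] too short for [t] would make [t] straddle the two subtrees. *)
rewrite mul0n emb_cons; case H: (emb (verts t) _) => //.
have := H; have := emb_size H; rewrite take_cat size_map ltnNge (ltnW ltE) /=.
case E2' : (take _ _) => [|y E2''].
  by rewrite /= cats0 size_map; move: ltE; rewrite /nverts /=; lia.
have /mapP[x _ ->] : y \in map (cons 1) E2.
  by apply: (@mem_take (nverts t - (size E1).+1)); rewrite E2' mem_head.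
by rewrite (negPf (emb_straddle _ _ _ _ _)).
Qed.

(** * Preorder and uniqueness of the embedding *)

(** The root [[::]] is an ancestor of every vertex, so the images of a second tree would be
    comparable with it. *)
Lemma emb_root fs E :
  emb (fverts 0 fs) ([::] :: E) =
  if fs is [:: Node gs] then emb (fverts 0 gs) E else false.
Proof.
case: fs => [|[gs] [|t fs]]; first by rewrite emb_nil.
  rewrite emb_singl emb_node; case: emb; rewrite ?andbF ?andbT //.
  by apply/allP => x _; rewrite prefix0s.
rewrite emb_cons; apply/negP => /and3P[_ emb_fs /allrelP np].
have: 0 < size (drop (nverts (Node gs)) ([::] :: E)).
  by rewrite (emb_size emb_fs) /= size_cat size_map -/(nverts t) ltn_addr ?nverts_gt0.
case def_d: drop => [|y E''] // _.
by have := np [::] y; rewrite def_d !mem_head prefix0s => /(_ isT isT).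
Qed.

(** Strict lexicographic order, proper prefixes first: the preorder of vertices. *)
Fixpoint plt (x y : seq nat) : bool :=
  match x, y with
  | [::], _ :: _ => true
  | a :: x', b :: y' => (a < b) || ((a == b) && plt x' y')
  | _, [::] => false
  end.

Lemma pltE x y : plt x y = leftof x y || (prefix x y && (x != y)).
Proof.
elim: x y => [|a x IH] [|b y] //=; rewrite IH eqseq_cons.
by case: ltngtP => //= _; rewrite ?andbF.
Qed.

Lemma plt_irr : irreflexive plt.
Proof. by elim=> //= a x ->; rewrite ltnn eqxx. Qed.

Lemma plt_trans : transitive plt.
Proof.
move=> y x z; elim: x y z => [|a x IH] [|b y] [|c z] //=.
case/orP => [ab|/andP[/eqP-> xy]] /orP[bc|/andP[/eqP<- yz]].
- by rewrite (ltn_trans ab bc).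
- by rewrite ab.
- by rewrite bc.
by rewrite eqxx (IH _ _ xy yz) orbT.
Qed.

Lemma leftof_notprefix x y : leftof x y -> prefix x y = false.
Proof.
elim: x y => [|a x IH] [|b y] //=.
by case: ltngtP => //= _ /IH.
Qed.

Lemma plt_prefix x y : plt x y -> prefix y x = false.
Proof.
elim: x y => [|a x IH] [|b y] //=.
by rewrite eq_sym; case: ltngtP => //= _ /IH.
Qed.

Lemma leftof_extend x y x' y' :
  leftof x y -> prefix x x' -> prefix y y' -> leftof x' y'.
Proof.
elim: x y x' y' => [|a x IH] [|b y] [|c x'] [|d y'] //=.
case/orP => [ab|/andP[/eqP-> xy]] /andP[/eqP<- px] /andP[/eqP<- py].
  by rewrite ab.
by rewrite eqxx (IH _ _ _ xy px py) orbT.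
Qed.

(** Here [c] is the lowest common ancestor. [good_map] controls the left-to-right order of siblings
    only, and this reduces [leftof] to them. *)
Lemma leftof_siblings x y : leftof x y ->
  exists c a b, [/\ prefix (rcons c a) x, prefix (rcons c b) y & a < b].
Proof.
elim: x y => [|a x IH] [|b y] //=.
case/orP => [ab|/andP[/eqP<- /IH[c [i [j [px py ij]]]]]].
  by exists [::], a, b; rewrite /= !eqxx !prefix0s.
by exists (a :: c), i, j; rewrite /= eqxx.
Qed.

Lemma sib_lt_rcons c a b : sib_lt (rcons c a) (rcons c b) = (a < b).
Proof. by rewrite /sib_lt !size_rcons !belast_rcons !last_rcons !eqxx. Qed.

Lemma sib_lt_leftof v w : sib_lt v w -> leftof v w.
Proof.
case/lastP: v => [|v a]; first by [].
case/lastP: w => [|w b]; first by rewrite /sib_lt size_rcons.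
case/and4P => _ _; rewrite !belast_rcons !last_rcons => /eqP[->] ab.
by elim: w => [|c w IH] /=; rewrite ?ab // eqxx IH orbT.
Qed.

Lemma mem_fverts i ts a v :
  (a :: v \in fverts i ts) =
  (i <= a < i + size ts) && (v \in verts (nth (Node [::]) ts (a - i))).
Proof.
elim: ts i => [|t ts IH] i /=; first by rewrite addn0; case: leqP => //= h1; rewrite ltnNge h1.
rewrite mem_cat IH; have [->|ne] := eqVneq a i.
  rewrite ltnn subnn leqnn addnS ltnS leq_addr orbF /=.
  by apply: mem_map => x y [].
have -> : (a :: v \in map (cons i) (verts t)) = false.
  by apply/mapP => -[x _ [h]]; rewrite h eqxx in ne.
rewrite /= addnS addSn; have [lt|ge] := ltnP i a.
  by rewrite (ltnW lt) -[a - i]prednK ?subn_gt0 //= subnS.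
by have -> : i <= a = false by apply/negbTE; lia.
Qed.

Lemma nil_notin_fverts i ts : [::] \notin fverts i ts.
Proof.
elim: ts i => [|t ts IH] i //=; rewrite mem_cat negb_or IH andbT.
by apply/mapP => -[].
Qed.

Lemma verts_prefix t x y : prefix x y -> y \in verts t -> x \in verts t.
Proof.
elim: x t y => [|a x IH] [ts] [|b y] //=; rewrite -/(verts (Node ts)) vertsE.
case/andP => /eqP-> xy; rewrite !inE /= !mem_fverts => /andP[-> /=].
exact: IH xy.
Qed.

Lemma verts_sorted t : pairwise plt (verts t).
Proof.
elim/tree_children_ind: t => ts IH; rewrite vertsE pairwise_cons.
apply/andP; split.
  apply/allP => -[|//]; by rewrite (negPf (nil_notin_fverts _ _)).
elim: ts 0 IH => [|t ts IHts] i IH //; rewrite [fverts _ _]/= pairwise_cat.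
apply/and3P; split.
- apply/allrelP => _ [|a w] /mapP[v _ ->]; first by rewrite (negPf (nil_notin_fverts _ _)).
  by rewrite mem_fverts /= => /andP[/andP[-> _] _].
- rewrite pairwise_map; move: (IH t (mem_head _ _)).
  by apply: sub_pairwise => x y /= ->; rewrite eqxx orbT.
by apply: IHts => t' t'_in; apply: IH; rewrite inE t'_in orbT.
Qed.

Lemma good_mapP S p : reflect
  (size p = nverts S /\ forall i j, i < nverts S -> j < nverts S ->
    (vle (nth [::] (verts S) i) (nth [::] (verts S) j) = vle (nth [::] p i) (nth [::] p j))
    /\ (sib_lt (nth [::] (verts S) i) (nth [::] (verts S) j) ->
         leftof (nth [::] p i) (nth [::] p j)))
  (good_map S p).
Proof.
apply: (iffP andP) => [[/eqP sp H]|[sp H]]; split; rewrite ?sp //.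
  move=> i j li lj; move/allP: H => /(_ i); rewrite mem_iota => /(_ li).
  move=> /allP/(_ j); rewrite mem_iota => /(_ lj) /andP[/eqP-> /implyP h].
  by split.
apply/allP => i; rewrite mem_iota => li; apply/allP => j; rewrite mem_iota => lj.
by have [-> /implyP->] := H i j li lj; rewrite eqxx.
Qed.

Lemma embP vs E : reflect
  (size E = size vs /\ forall i j, i < j -> j < size vs ->
    prefix (nth [::] vs i) (nth [::] vs j) = prefix (nth [::] E i) (nth [::] E j))
  (emb vs E).
Proof.
apply: (iffP andP) => [[/eqP sE H]|[sE H]]; split; rewrite ?sE //.
  move=> i j ij lj; move/(pairwiseP ([::], [::])): H => /(_ i j).
  rewrite !inE size_zip sE minnn !nth_zip // => /(_ (ltn_trans ij lj) lj ij).
  by move/eqP.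
apply/(pairwiseP ([::], [::])) => i j; rewrite !inE size_zip sE minnn !nth_zip // => li lj ij.
by apply/eqP; apply: H.
Qed.

(** Consecutive vertices of [S] are either nested, and then so are their images, or lie below
    siblings [rcons c a] and [rcons c b]; the images of these siblings are related by [leftof],
    which passes to descendants. *)
Lemma good_map_sorted S p : good_map S p -> sorted plt p.
Proof.
case/good_mapP => sp H; apply/(sortedP [::]) => i; rewrite sp => li.
set vs := verts S in H.
have lii : i < nverts S by apply: ltnW.
have : plt (nth [::] vs i) (nth [::] vs i.+1).
  by apply: (pairwiseP [::] (verts_sorted S)); rewrite ?inE.
rewrite !pltE => /orP[lft|/andP[pre ne]]; last first.
  have [e1 _] := H _ _ li lii; have [e2 _] := H _ _ lii li.
  move: e1 e2; rewrite /vle pre => <-.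
  have -> : prefix (nth [::] vs i.+1) (nth [::] vs i) = false.
    by apply: plt_prefix; rewrite pltE pre ne orbT.
  by case: eqP => [->|]; rewrite ?prefix_refl ?orbT.
have [c [a [b [pa pb ab]]]] := leftof_siblings lft.
have ina : rcons c a \in vs by apply: verts_prefix pa _; apply: mem_nth.
have inb : rcons c b \in vs by apply: verts_prefix pb _; apply: mem_nth.
have la : index (rcons c a) vs < nverts S by rewrite index_mem.
have lb : index (rcons c b) vs < nverts S by rewrite index_mem.
have [_] := H _ _ la lb; rewrite !nth_index // sib_lt_rcons => /(_ ab) lf.
have [e1 _] := H _ _ lii la; have [e2 _] := H _ _ li lb.
move: e1 e2; rewrite !nth_index // /vle pa pb => e1 e2.
by rewrite (leftof_extend lf).
Qed.

(** A good listing of [E] is sorted by [plt], as [E] is, so the two coincide. Conversely, [emb]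
    tests ancestry in one direction only: the other direction fails on both sides by sortedness, and
    sorted images that are not nested are related by [leftof]. *)
Lemma is_embeddingE S E : pairwise plt E -> is_embedding S E = emb (verts S) E.
Proof.
move=> sE; apply/hasP/embP => [[p]|[szE H]].
  rewrite mem_permutations => pE g.
  have {pE} <- : p = E.
    apply: (irr_sorted_eq plt_trans plt_irr (good_map_sorted g) (pairwise_sorted sE)).
    exact: perm_mem.
  case/good_mapP: g => sp H; split=> // i j ij lj.
  by have [] := H j i lj (ltn_trans ij lj).
exists E; first by rewrite mem_permutations.
apply/good_mapP; split=> // i j li lj.
have sv := pairwiseP [::] (verts_sorted S); have sE' := pairwiseP [::] sE.
rewrite /vle; case: (ltngtP i j) => [ij|ji|<-].
- have pv := sv i j li lj ij.
  have pE : plt (nth [::] E i) (nth [::] E j) by apply: sE'; rewrite ?inE ?szE.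
  rewrite !plt_prefix //; split=> // /sib_lt_leftof/leftof_notprefix npre.
  by move: pE; rewrite pltE -H // npre orbF.
- have pv := sv j i lj li ji.
  rewrite H //; split=> // /sib_lt_leftof lf.
  have := plt_trans pv (y := nth [::] (verts S) i) (z := nth [::] (verts S) j).
  by rewrite [plt (nth _ _ i) _]pltE lf plt_irr => /(_ isT).
- rewrite !prefix_refl; split=> // /sib_lt_leftof/leftof_notprefix.
  by rewrite prefix_refl.
Qed.

Lemma a_TE T S :
  a_T T S = count (fun m => emb (fverts 0 [:: S]) (mask m (verts T))) (bitseqs (nverts T)).
Proof.
rewrite /a_T; apply: eq_count => m; rewrite emb_singl.
by rewrite is_embeddingE // pairwise_mask // verts_sorted.
Qed.

(** * Counting over binary trees *)

Lemma size_bitseqs k s : s \in bitseqs k -> size s = k.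
Proof.
elim: k s => [|k IH] s; first by rewrite inE => /eqP->.
by rewrite /bitseqs -/bitseqs => /allpairsP[[b s'] /= [_ /IH<- ->]].
Qed.

Lemma sum_bitseqsS k (F : bitseq -> nat) :
  \sum_(s <- bitseqs k.+1) F s =
  \sum_(s <- bitseqs k) F (true :: s) + \sum_(s <- bitseqs k) F (false :: s).
Proof. by rewrite /bitseqs -/bitseqs big_allpairs_dep /= !big_cons big_nil addn0. Qed.

Lemma sum_bitseqs_add a b (F : bitseq -> nat) :
  \sum_(s <- bitseqs (a + b)) F s =
  \sum_(s <- bitseqs a) \sum_(t <- bitseqs b) F (s ++ t).
Proof.
elim: a F => [|a IH] F; first by rewrite big_seq1.
by rewrite addSn !sum_bitseqsS !IH.
Qed.

(** Embeddings of the plane forest [fs] into [T]; for [fs = [:: S]] this is [a_T T S]. *)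
Definition cnt (fs : seq tree) (T : tree) : nat :=
  \sum_(s <- bitseqs (nverts T)) emb (fverts 0 fs) (mask s (verts T)).

(** Embeddings of [fs] into [Node [:: l; r]] that avoid its root. *)
Definition cnt2 (fs : seq tree) (l r : tree) : nat :=
  \sum_(j < (size fs).+1) cnt (take j fs) l * cnt (drop j fs) r.

Lemma emb_fverts_nil fs : emb (fverts 0 fs) [::] = (fs == [::]).
Proof.
case: fs => [|t fs]; first by rewrite emb_nil.
apply/negP => /emb_size; rewrite size_fverts big_cons /=.
by have := nverts_gt0 t; lia.
Qed.

Lemma cnt_leaf fs : cnt fs (Node [::]) = (fs == [::]) + (fs == [:: Node [::]]).
Proof.
rewrite /cnt [nverts _]/= sum_bitseqsS !big_seq1 /= emb_root emb_fverts_nil addnC.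
case: fs => [|[gs] [|t fs]] //; rewrite ?emb_fverts_nil ?eqseq_cons ?andbF ?andbT //.
by congr (_ + nat_of_bool _); apply/eqP/eqP => [->|[]].
Qed.

Lemma cnt2E fs l r :
  \sum_(s <- bitseqs (nverts l + nverts r))
    emb (fverts 0 fs) (mask s (map (cons 0) (verts l) ++ map (cons 1) (verts r)))
  = cnt2 fs l r.
Proof.
rewrite sum_bitseqs_add /cnt2 /cnt.
under [RHS]eq_bigr => j _.
  rewrite big_distrl /=; under eq_bigr => s _ do rewrite big_distrr /=; over.
rewrite [RHS]exchange_big /= big_seq [RHS]big_seq; apply: eq_bigr => s s_in.
rewrite [RHS]exchange_big /=; apply: eq_bigr => t _.
by rewrite mask_cat ?size_map ?(size_bitseqs s_in) // -!map_mask emb_branch.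
Qed.

(** The terms count the image sets without and with the root of the binary tree, according to the
    first bit of the mask. *)
Lemma cnt_branch fs l r :
  cnt fs (Node [:: l; r]) =
  cnt2 fs l r + (if fs is [:: Node gs] then cnt2 gs l r else 0).
Proof.
rewrite /cnt nvertsE !big_cons big_nil addn0 sum_bitseqsS vertsE /= cats0 addnC.
rewrite cnt2E; congr (_ + _); under eq_bigr => s _ do rewrite emb_root.
by case: fs => [|[gs] [|t fs]]; [apply: big1 | apply: cnt2E | apply: big1].
Qed.

(* The first argument is fuel: [bintrees d n] lists the binary trees with [n]
   vertices as soon as [n <= d]. *)
Fixpoint bintrees (d n : nat) : seq tree :=
  match d, n with
  | d'.+1, n'.+1 =>
      nseq (n' == 0) (Node [::]) ++
      flatten [seq [seq Node [:: l; r] | l <- bintrees d' i, r <- bintrees d' (n' - i)]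
              | i <- index_iota 0 n'.+1]
  | _, _ => [::]
  end.

Lemma bintreesSS d n :
  bintrees d.+1 n.+1 = nseq (n == 0) (Node [::]) ++
    flatten [seq [seq Node [:: l; r] | l <- bintrees d i, r <- bintrees d (n - i)]
            | i <- index_iota 0 n.+1].
Proof. by []. Qed.

Lemma is_binaryE ts :
  is_binary (Node ts) = ((size ts == 0) || (size ts == 2)) && all is_binary ts.
Proof. by []. Qed.

Lemma count_sum (T : Type) (P : pred T) s : count P s = \sum_(x <- s) P x.
Proof. by elim: s => [|x s IH]; rewrite ?big_nil // big_cons -IH. Qed.

Lemma count_node2 T s1 s2 :
  count_mem T [seq Node [:: l; r] | l <- s1, r <- s2] =
  if T is Node [:: a; b] then count_mem a s1 * count_mem b s2 else 0.
Proof.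
rewrite count_sum big_allpairs_dep /=.
have zero : (forall l r, Node [:: l; r] != T) ->
    \sum_(l <- s1) \sum_(r <- s2) (Node [:: l; r] == T) = 0.
  by move=> ne; rewrite big1 // => l _; rewrite big1 // => r _; rewrite (negPf (ne l r)).
case: T zero => [[|a [|b [|c ts]]]] zero; try by apply: zero => l r; apply/eqP.
rewrite !count_sum big_distrl; apply: eq_bigr => l _.
rewrite big_distrr; apply: eq_bigr => r _ /=.
by rewrite mulnb; congr nat_of_bool; apply/eqP/andP => [[-> ->]|[/eqP-> /eqP->]] //.
Qed.

(** Multiplicities give soundness, completeness and absence of duplicates at once, and show that the
    fuel does not affect sums. *)
Lemma count_bintrees d n T :
  n <= d -> count_mem T (bintrees d n) = is_binary T && (nverts T == n).
Proof.
elim: d n T => [|d IH] [|n] T le_nd; try by rewrite gtn_eqF ?nverts_gt0 ?andbF.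
rewrite bintreesSS count_cat count_nseq count_flatten -map_comp sumnE big_map.
under eq_bigr => i _ do rewrite /= count_node2.
have ne a ts : pred1 (Node (a :: ts)) (Node [::]) = false by apply/eqP.
case: T => [[|a [|b [|c ts]]]].
- by rewrite big1 // addn0 /= eqxx mul1n; case: n {le_nd}.
- by rewrite ne big1.
- have -> : nverts (Node [:: a; b]) = (nverts a + nverts b).+1.
    by rewrite nvertsE !big_cons big_nil addn0.
  rewrite ne add0n is_binaryE [_ || _]/= [all _ _]/= eqSS andTb andbT.
  (* Only the split with [i = nverts a] produces [Node [:: a; b]]. *)
  transitivity (\sum_(0 <= i < n.+1)
      (i == nverts a) * (is_binary a && is_binary b && (nverts a + nverts b == n))).
    rewrite big_seq [RHS]big_seq; apply: eq_bigr => i.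
    rewrite mem_index_iota ltnS => /andP[_ le_in].
    rewrite !IH; try lia.
  rewrite eqSS; case: eqP => [sum_n|_]; rewrite ?andbF ?andbT; last first.
    by apply: big1 => i _; rewrite muln0.
  have le_an : nverts a < n.+1 by rewrite -sum_n ltnS leq_addr.
  rewrite big_mkord (bigD1 (Ordinal le_an)) //= eqxx mul1n big1 ?addn0 //.
  by move=> i; rewrite -val_eqE /= => /negPf->.
- by rewrite ne big1.
Qed.

Definition emb_series (fs : seq tree) : series :=
  fun n => \sum_(T <- bintrees n n) cnt fs T.

Lemma sum_bintrees d n (F : tree -> nat) : n <= d ->
  \sum_(T <- bintrees d n) F T = \sum_(T <- bintrees n n) F T.
Proof.
move=> le_nd; apply: perm_big; apply/allP => T _ /=.
by rewrite !count_bintrees.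
Qed.

Lemma emb_seriesS fs n :
  emb_series fs n.+1 = (n == 0) * cnt fs (Node [::]) +
    \sum_(i < n.+1) \sum_(l <- bintrees i i) \sum_(r <- bintrees (n - i) (n - i))
      cnt fs (Node [:: l; r]).
Proof.
rewrite /emb_series bintreesSS big_cat big_flatten big_map; congr (_ + _).
  by case: (n == 0); rewrite ?big_seq1 ?big_nil ?mul1n.
rewrite big_mkord; apply: eq_bigr => i _.
rewrite big_allpairs_dep /= [LHS]sum_bintrees -1?ltnS //.
by apply: eq_bigr => l _; rewrite sum_bintrees // leq_subr.
Qed.

Lemma List_InP (T : eqType) (x : T) s : reflect (List.In x s) (x \in s).
Proof.
elim: s => [|y s IH]; first by right.
rewrite inE eq_sym; apply: (iffP orP) => -[].
- by move/eqP; left.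
- by move/IH; right.
- by move/eqP; left.
- by move/IH; right.
Qed.

Lemma NoDup_uniq (T : eqType) (s : seq T) : List.NoDup s -> uniq s.
Proof.
by elim=> //= x l nin _ ->; rewrite andbT; apply/negP => /List_InP.
Qed.

Lemma sum_aT_series (S : tree) n (L : seq tree) :
  List.NoDup L -> (forall T, List.In T L <-> (is_binary T /\ nverts T = n)) ->
  sumn [seq a_T T S | T <- L] = emb_series [:: S] n.
Proof.
move=> uL memL; rewrite sumnE big_map.
rewrite (perm_big (bintrees n n)) /=; last first.
  apply: uniq_perm => [||T].
  - exact: NoDup_uniq.
  - apply: count_mem_uniq => T; rewrite count_bintrees //.
    have -> : (T \in bintrees n n) = (0 < count_mem T (bintrees n n)).
      by rewrite -has_pred1 has_count.
    by rewrite count_bintrees //; case: andP.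
  rewrite -[T \in bintrees n n]has_pred1 has_count count_bintrees //.
  apply/idP/idP => [/List_InP/memL[-> ->]|]; first by rewrite eqxx.
  by rewrite lt0b => /andP[bT /eqP nT]; apply/List_InP/memL.
by apply: eq_bigr => T _; rewrite a_TE count_sum.
Qed.

(** * Formal power series with natural coefficients *)

Definition szero : series := fun=> 0.
Definition sadd (F G : series) : series := fun n => F n + G n.

(* The n-th coefficient of a product only depends on truncations of the
   factors, so the laws are inherited from [{poly nat}]. *)
Section PolyModel.
Import ssralg poly.

Definition trunc (N : nat) (F : series) : {poly nat} := \poly_(i < N) F i.

Lemma coef_trunc N F i : i < N -> ((trunc N F)`_i)%R = F i.
Proof. by move=> ltiN; rewrite coef_poly ltiN. Qed.

Lemma coef_smul N F G n :
  n < N -> smul F G n = ((trunc N F * trunc N G)`_n)%R.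
Proof.
move=> ltnN; rewrite coefM /=; apply: eq_bigr => i _.
by have := ltn_ord i => lt_in; rewrite !coef_trunc //; lia.
Qed.

Lemma smulC F G : smul F G = smul G F.
Proof.
apply: functional_extensionality => n.
by rewrite !(coef_smul _ _ (ltnSn n)) GRing.mulrC.
Qed.

Lemma smulA F G H : smul F (smul G H) = smul (smul F G) H.
Proof.
apply: functional_extensionality => n; pose N := n.+1.
transitivity (((trunc N F * (trunc N G * trunc N H))`_n)%R).
  rewrite coefM /=; apply: eq_bigr => i _; rewrite coef_trunc ?ltn_ord //.
  by rewrite (@coef_smul N) //; rewrite ltnS leq_subr.
rewrite GRing.mulrA coefM; apply: eq_bigr => i _; rewrite coef_trunc ?ltnS ?leq_subr //.
by rewrite (@coef_smul N).
Qed.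
End PolyModel.

Lemma saddC F G : sadd F G = sadd G F.
Proof. by apply: functional_extensionality => n; rewrite /sadd addnC. Qed.
Lemma saddA F G H : sadd F (sadd G H) = sadd (sadd F G) H.
Proof. by apply: functional_extensionality => n; rewrite /sadd addnA. Qed.
Lemma sadd0 F : sadd szero F = F.
Proof. by apply: functional_extensionality. Qed.
Lemma smul1 F : smul sone F = F.
Proof.
apply: functional_extensionality => n.
rewrite /smul big_ord_recl /= subn0 mul1n big1 ?addn0 // => i _.
Qed.
Lemma smul0 F : smul szero F = szero.
Proof. by apply: functional_extensionality => n; apply: big1. Qed.
Lemma smulDl F G H : smul (sadd F G) H = sadd (smul F H) (smul G H).
Proof.
apply: functional_extensionality => n; rewrite /sadd /smul -big_split /=.
by apply: eq_bigr => i _; rewrite mulnDl.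
Qed.

HB.instance Definition _ := Monoid.isComLaw.Build series sone smul smulA smulC smul1.

Lemma series_semiring : semi_ring_theory szero sone sadd smul eq.
Proof.
split; [exact: sadd0 | exact: saddC | exact: saddA | exact: smul1 | exact: smul0
       | exact: smulC | exact: smulA | exact: smulDl].
Qed.

Add Ring series_ring : series_semiring.

Lemma sscaleE c F : sscale c F = smul (sscale c sone) F.
Proof.
apply: functional_extensionality => n.
rewrite /smul big_ord_recl /= subn0 /sscale /sone muln1 big1 ?addn0 // => i _.
by rewrite muln0.
Qed.

Lemma sscaleM a b F : sscale (a * b) F = sscale a (sscale b F).
Proof. by apply: functional_extensionality => n; rewrite /sscale mulnA. Qed.

Lemma sscale1 F : sscale 1 F = F.
Proof. by apply: functional_extensionality => n; rewrite /sscale mul1n. Qed.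

Lemma sscale2 F : sscale 2 F = sadd F F.
Proof. by apply: functional_extensionality => n; rewrite /sscale /sadd mul2n addnn. Qed.

Lemma sscale_mull c F G : smul (sscale c F) G = sscale c (smul F G).
Proof. by rewrite sscaleE -smulA -sscaleE. Qed.

Lemma sscale_mulr c F G : smul F (sscale c G) = sscale c (smul F G).
Proof. by rewrite smulC sscale_mull smulC. Qed.

Lemma spowS F k : spow F k.+1 = smul F (spow F k).
Proof. by []. Qed.

Lemma spowD F a b : spow F (a + b) = smul (spow F a) (spow F b).
Proof. by elim: a => [|a IH]; rewrite ?smul1 // addSn !spowS IH smulA. Qed.

Lemma sX_mul0 F : smul sX F 0 = 0.
Proof. by rewrite /smul big_ord_recl big_ord0. Qed.

Lemma sX_mulS F n : smul sX F n.+1 = F n.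
Proof.
rewrite /smul 2!big_ord_recl /= mul0n add0n mul1n subSS subn0 big1 ?addn0 //.
Qed.

(** As [F 0 = 0], the coefficient [n] of [smul F Y] involves only earlier coefficients of [Y]. This
    stands in for division by [1 - F], natural coefficients having no subtraction. *)
Lemma fixpoint_unique F G Y Z : F 0 = 0 ->
  Y = sadd G (smul F Y) -> Z = sadd G (smul F Z) -> Y = Z.
Proof.
move=> F0 eY eZ; apply: functional_extensionality => n.
elim/ltn_ind: n => n IH; rewrite eY eZ /sadd /smul; congr (_ + _).
apply: eq_bigr => -[[|i] /= lt_in] _; first by rewrite F0.
by rewrite IH //; lia.
Qed.

Lemma spow_small F j n : F 0 = 0 -> n < j -> spow F j n = 0.
Proof.
move=> F0; elim: j n => // j IH n lt_nj; rewrite spowS /smul big1 // => -[[|i] /= lt_in] _.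
  by rewrite F0.
by rewrite IH ?muln0 //; lia.
Qed.

Lemma sgeomE F n N : F 0 = 0 -> n < N -> sgeom F n = \sum_(j < N) spow F j n.
Proof.
move=> F0 lt_nN; rewrite /sgeom (big_ord_widen N (fun j => spow F j n)) //.
rewrite big_mkcond; apply: eq_bigr => j _; case: ltnP => // lt_nj.
by rewrite spow_small.
Qed.

Lemma sgeom_fix F : F 0 = 0 -> sgeom F = sadd sone (smul F (sgeom F)).
Proof.
move=> F0; apply: functional_extensionality => n.
(* Splitting off [F^0] from [n.+2] terms leaves [n.+1], the common bound given to the inner sums
   below. *)
rewrite (@sgeomE F n n.+2) // big_ord_recl /sadd; congr (_ + _).
rewrite /smul; under [RHS]eq_bigr => i _.
  rewrite (@sgeomE F _ n.+1) // ?ltnS ?leq_subr // big_distrr /=; over.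
by rewrite exchange_big.
Qed.

Lemma sgeom_solve F G Y : F 0 = 0 -> Y = sadd G (smul F Y) -> Y = smul (sgeom F) G.
Proof.
move=> F0 eY; apply: (fixpoint_unique F0 eY).
by rewrite [in LHS](sgeom_fix F0); ring.
Qed.

(** * Catalan numbers *)

Lemma catalan_bin k : k.+1 * catalan k = 'C(k.*2, k).
Proof.
(* The quotient is this difference because [k.+1 * 'C(k.*2, k.+1) = k * 'C(k.*2, k)]. *)
rewrite /catalan mulnC divnK //; apply/dvdnP; exists ('C(k.*2, k) - 'C(k.*2, k.+1)).
rewrite mulnBl ![_ * k.+1]mulnC mul_bin_left -addnn addnK mulSn addnn.
by rewrite addnK.
Qed.

Lemma catalan0 : catalan 0 = 1. Proof. by []. Qed.

Lemma catalanS k : k.+2 * catalan k.+1 = (k * 4 + 2) * catalan k.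
Proof.
(* The recurrence of central binomial coefficients, passing through ['C(k.*2.+1, k)]. *)
have cb : k.+1 * 'C(k.+1.*2, k.+1) = (k * 4 + 2) * 'C(k.*2, k).
  have /= := mul_bin_diag k.*2.+2 k; have /= := mul_bin_down k.*2.+1 k.
  have -> : k.*2.+1 - k = k.+1 by lia.
  rewrite doubleS => b2 <-; have -> : k.*2.+2 = 2 * k.+1 by lia.
  by rewrite -mulnA -b2; lia.
rewrite catalan_bin; apply/eqP; rewrite -(eqn_pmul2l (ltn0Sn k)) cb.
by rewrite -catalan_bin mulnCA.
Qed.

(* By symmetry [2 T n = n S n]; the first-order recurrence [catalanS] makes
   [T n.+1 + S n.+1] a linear combination of [T n] and [S n], which gives for [S]
   the recurrence satisfied by [fun n => catalan n.+1]. *)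
Lemma catalan_conv n : catalan n.+1 = \sum_(i < n.+1) catalan i * catalan (n - i).
Proof.
pose S n := \sum_(i < n.+1) catalan i * catalan (n - i).
pose T n := \sum_(i < n.+1) i * (catalan i * catalan (n - i)).
have symT m : (T m).*2 = m * S m.
  rewrite -addnn {2}/T (reindex_inj rev_ord_inj) /= -big_split /S big_distrr /=.
  apply: eq_bigr => i _; rewrite subSS subKn -1?ltnS //.
  rewrite [catalan (m - i) * _]mulnC -mulnDl subnKC // -ltnS //.
have TS m : T m.+1 + S m.+1 = catalan m.+1 + 4 * T m + 2 * S m.
  rewrite /T /S -big_split /= big_ord_recl mul0n add0n catalan0 mul1n subn0.
  rewrite -addnA; congr (_ + _); rewrite !big_distrr -big_split /=.
  apply: eq_bigr => i _; rewrite /bump /= add1n subSS.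
  by have := catalanS i; nia.
rewrite -/(S n); elim: n => [|n IH]; first by rewrite /S big_ord_recl big_ord0.
have := TS n; have := symT n; have := symT n.+1; rewrite -IH; have := catalanS n.+1.
nia.
Qed.

(** * Functional equations *)

(** Embeddings of [fs] into pairs of binary trees; a root above the pair costs a further factor
    [sX]. *)
Definition split_series (fs : seq tree) : series := fun n =>
  \sum_(j < (size fs).+1) smul (emb_series (take j fs)) (emb_series (drop j fs)) n.

Lemma sum_cnt2 fs n :
  \sum_(i < n.+1) \sum_(l <- bintrees i i) \sum_(r <- bintrees (n - i) (n - i)) cnt2 fs l r
  = split_series fs n.
Proof.
rewrite /split_series exchange_big /=; apply: eq_bigr => i _.
rewrite /cnt2; under eq_bigr => l _ do rewrite exchange_big /=.
rewrite exchange_big /=; apply: eq_bigr => j _.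
by rewrite /emb_series big_distrl; apply: eq_bigr => l _; rewrite big_distrr.
Qed.

Lemma emb_series0 fs : emb_series fs 0 = 0.
Proof. by rewrite /emb_series big_nil. Qed.

(** The first summand comes from the one-vertex binary tree; in the second, [sX] counts the root and
    the two terms are those of [cnt_branch]. *)
Lemma emb_series_eq fs :
  emb_series fs =
  sadd (sscale ((fs == [::]) + (fs == [:: Node [::]])) sX)
    (smul sX (sadd (split_series fs)
       (if fs is [:: Node gs] then split_series gs else szero))).
Proof.
apply: functional_extensionality => -[|n].
  by rewrite /sadd sX_mul0 emb_series0 /sscale /sX muln0.
rewrite emb_seriesS /sadd sX_mulS cnt_leaf mulnC /sscale /sX eqSS; congr (_ + _).
under eq_bigr => i _ do under eq_bigr => l _ do under eq_bigr => r _ do rewrite cnt_branch.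
under eq_bigr => i _ do under eq_bigr => l _ do rewrite big_split /=.
under eq_bigr => i _ do rewrite big_split /=.
rewrite big_split /= sum_cnt2; congr (_ + _).
case: fs => [|[gs] [|t fs]]; last 1 [apply: big1 => i _; rewrite big1 // => l _; exact: big1].
- by rewrite big1 // => i _; rewrite big1 // => l _; apply: big1.
exact: sum_cnt2.
Qed.

Lemma quadratic_unique F G :
  F = sadd sX (smul sX (smul F F)) -> G = sadd sX (smul sX (smul G G)) -> F = G.
Proof.
move=> eF eG; apply: functional_extensionality => n.
elim/ltn_ind: n => -[|n] IH; rewrite eF eG /sadd ?sX_mul0 // !sX_mulS.
by congr (_ + _); apply: eq_bigr => i _; rewrite !IH // ltnS ?leq_subr // -ltnS.
Qed.

Lemma sum_ord_double n (F : nat -> nat) :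
  \sum_(i < n.*2) F i = \sum_(i < n) (F i.*2 + F i.*2.+1).
Proof.
elim: n => [|n IH]; first by rewrite !big_ord0.
by rewrite doubleS !big_ord_recr /= IH addnA.
Qed.

Lemma Bser_fix : Bser = sadd sX (smul sX (smul Bser Bser)).
Proof.
apply: functional_extensionality => -[|n]; first by rewrite /sadd sX_mul0.
rewrite /sadd sX_mulS /sX eqSS /smul; have [odn|evn] := boolP (odd n).
  rewrite {1}/Bser /= odn big1 => [|i _]; first by case: n odn.
  have := ltn_ord i; rewrite ltnS => le_in.
  by rewrite /Bser oddB // odn; case: odd; rewrite ?muln0.
(* For even [n] only odd indices contribute, and they form the Catalan convolution. *)
have def_n : n = n./2.*2 by rewrite -[LHS]odd_double_half (negPf evn).
rewrite def_n; move: n./2 => k {def_n evn n}.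
rewrite {1}/Bser /= odd_double /= uphalf_double.
case: k => [|k]; first by rewrite big_ord_recl big_ord0.
rewrite big_ord_recr (sum_ord_double k.+1 (fun i => Bser i * Bser (k.+1.*2 - i))).
have -> : Bser (@ord_max k.+1.*2) = 0 by rewrite /Bser [nat_of_ord _]/= odd_double.
rewrite [_ == _]/= add0n mul0n Monoid.mulm1 /Bser catalan_conv.
apply: eq_bigr => i _; have := ltn_ord i; rewrite ltnS => le_ik.
rewrite /= odd_double /= mul0n add0n uphalf_double; congr (_ * _).
have -> : k.+1.*2 - i.*2.+1 = (k - i).*2.+1 by lia.
by rewrite /= odd_double /= uphalf_double.
Qed.

(** The empty forest embeds once into each binary tree, so both sides satisfy [B = z + z B^2]. *)
Lemma emb_series_nil : emb_series [::] = Bser.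
Proof.
apply: quadratic_unique Bser_fix; rewrite {1}emb_series_eq /= sscale1.
congr (sadd _ (smul _ _)); apply: functional_extensionality => n.
by rewrite /sadd /split_series big_ord_recl big_ord0 /szero !addn0.
Qed.

Notation twoXB := (sscale 2 (smul sX Bser)).

Lemma twoXB0 : twoXB 0 = 0.
Proof. by rewrite /sscale sX_mul0. Qed.

(* The splits of [fs] into two nonempty parts. *)
Definition inner_series (fs : seq tree) : series := fun n =>
  \sum_(j < (size fs).-1) smul (emb_series (take j.+1 fs)) (emb_series (drop j.+1 fs)) n.

Lemma split_series_cons t ts :
  split_series (t :: ts) =
  sadd (inner_series (t :: ts)) (sscale 2 (smul Bser (emb_series (t :: ts)))).
Proof.
apply: functional_extensionality => n.
rewrite /split_series big_ord_recl big_ord_recr /= drop_size take_size emb_series_nil.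
rewrite /sadd /sscale mul2n -addnn [smul (emb_series _) Bser]smulC /inner_series /=.
by rewrite addnCA addnA.
Qed.

(** With two or more trees the root is never an image, and the two extreme splits give the term
    [2zB A(fs)] to be solved for. *)
Lemma emb_series_forest2 t t' ts (fs := [:: t, t' & ts]) :
  emb_series fs = smul (sgeom twoXB) (smul sX (inner_series fs)).
Proof.
apply: sgeom_solve; first exact: twoXB0.
rewrite {1}emb_series_eq /fs; case: t @fs => gs fs.
have -> : (fs == [::]) + (fs == [:: Node [::]]) = 0.
  by apply/eqP; rewrite addn_eq0 !eqb0; apply/andP; split; apply/eqP.
rewrite split_series_cons !sscale2 -/fs.
have -> : sscale 0 sX = szero by [].
ring.
Qed.

Lemma emb_series_tree gs :
  emb_series [:: Node gs] =
  smul (sgeom twoXB)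
    (sadd (sscale (gs == [::]) sX) (smul sX (split_series gs))).
Proof.
apply: sgeom_solve; first exact: twoXB0.
rewrite {1}emb_series_eq split_series_cons.
have -> : inner_series [:: Node gs] = szero.
  by apply: functional_extensionality => n; rewrite /inner_series big_ord0.
have -> : ([:: Node gs] == [::]) + ([:: Node gs] == [:: Node [::]]) = (gs == [::]).
  by congr nat_of_bool; apply/eqP/eqP => [[]|->].
rewrite !sscale2; ring.
Qed.

(** * Degree distribution and the closed formula *)

Lemma spowM F G k : spow (smul F G) k = smul (spow F k) (spow G k).
Proof.
elim: k => [|k IH]; first by rewrite smul1.
by rewrite !spowS IH; ring.
Qed.

Notation treeprod fs := (\big[smul/sone]_(t <- fs) emb_series [:: t]).

Lemma sscale_sumr (I : Type) (r : seq I) (c : I -> nat) F :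
  (fun n => \sum_(i <- r) sscale (c i) F n) = sscale (\sum_(i <- r) c i) F.
Proof. by apply: functional_extensionality => n; rewrite /sscale big_distrl. Qed.

Lemma emb_series_forest fs : 0 < size fs ->
  emb_series fs =
  sscale (catalan (size fs).-1)
    (smul (spow (smul sX (sgeom twoXB)) (size fs).-1) (treeprod fs)).
Proof.
move: {2}(size fs) (leqnn (size fs)) => n; elim: n fs => [|n IH] [|t [|t' ts]] //= le_n _.
  by rewrite sscale1 big_seq1 smul1.
rewrite emb_series_forest2; set fs := [:: t, t' & ts].
pose Q := smul (spow (smul sX (sgeom twoXB)) (size ts)) (treeprod fs).
(* All inner splits yield the same series [Q], as the exponents [i] and [size ts - i] add up; only
   the Catalan factors vary. *)
have -> : inner_series fs = sscale (catalan (size ts).+1) Q.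
  rewrite catalan_conv -sscale_sumr; apply: functional_extensionality => m.
  apply: eq_bigr => i _; have le_i : i <= size ts by rewrite -ltnS; apply: ltn_ord.
  have st : size (take i.+1 fs) = i.+1 by rewrite size_takel //= ltnS leqW.
  have sd : size (drop i.+1 fs) = (size ts - i).+1 by rewrite size_drop /= subSS subSn.
  rewrite !IH ?st ?sd //; try lia.
  rewrite sscale_mull sscale_mulr -sscaleM; congr (sscale _ _ m).
  have -> : Q = smul (smul (spow (smul sX (sgeom twoXB)) i)
      (spow (smul sX (sgeom twoXB)) (size ts - i)))
      (smul (treeprod (take i.+1 fs)) (treeprod (drop i.+1 fs))).
    by rewrite -spowD subnKC // -big_cat cat_take_drop.
  by rewrite !succnK; ring.
rewrite !sscale_mulr; congr sscale; rewrite /Q; ring.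
Qed.

Lemma count_fverts (P : pred (seq nat)) i ts :
  count P (fverts i ts) =
  \sum_(j < size ts) count (fun v => P (i + j :: v)) (verts (nth (Node [::]) ts j)).
Proof.
elim: ts i => [|t ts IH] i; first by rewrite big_ord0.
rewrite big_ord_recl addn0 [fverts _ _]/= count_cat count_map IH; congr (_ + _).
by apply: eq_bigr => j _; apply: eq_count => v; rewrite addSnnS.
Qed.

Lemma count_root t : count (fun w => size w == 0) (verts t) = 1.
Proof.
case: t => ts; rewrite vertsE /= count_fverts big1 // => j _.
by elim: verts.
Qed.

Lemma outdeg_root ts : outdeg (Node ts) [::] = size ts.
Proof.
rewrite /outdeg vertsE /= count_fverts -[RHS]card_ord -sum1_card.
apply: eq_bigr => j _; rewrite -[RHS](count_root (nth (Node [::]) ts j)).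
by apply: eq_count => w /=; rewrite andbT.
Qed.

Lemma outdeg_child ts j v : j < size ts ->
  outdeg (Node ts) (j :: v) = outdeg (nth (Node [::]) ts j) v.
Proof.
move=> lt_j; rewrite /outdeg vertsE /= count_fverts.
rewrite (bigD1 (Ordinal lt_j)) //= big1 ?addn0 ?add0n => [|i].
  by apply: eq_count => w /=; rewrite eqSS eqxx.
rewrite -val_eqE /= eq_sym => /negPf ne; rewrite (eq_count (a2 := pred0)) ?count_pred0 // => w /=.
by rewrite add0n ne andbF.
Qed.

Lemma degcountE ts i :
  degcount (Node ts) i = (size ts == i) + \sum_(t <- ts) degcount t i.
Proof.
rewrite /degcount vertsE /= outdeg_root count_fverts; congr (_ + _).
rewrite (big_nth (Node [::])) big_mkord; apply: eq_bigr => j _.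
by apply: eq_count => v; rewrite add0n outdeg_child ?ltn_ord.
Qed.

Lemma degcount0_gt0 t : 0 < degcount t 0.
Proof.
elim/tree_children_ind: t => -[|t ts] IH; first by rewrite degcountE.
by rewrite degcountE big_cons !addn_gt0 IH ?mem_head ?orbT.
Qed.

Lemma degcount_large t i : nverts t <= i -> degcount t i = 0.
Proof.
elim/tree_children_ind: t => ts IH; rewrite nvertsE degcountE => lt_i.
have size_le : size ts <= \sum_(t <- ts) nverts t.
  by rewrite -sum1_size; apply: leq_sum => t _; apply: nverts_gt0.
rewrite ltn_eqF ?(leq_ltn_trans size_le) // big1_seq // => t /= t_in.
apply: IH => //; apply: leq_trans (ltnW lt_i).
by rewrite (big_rem t) //= leq_addr.
Qed.

(** Factor of a vertex with [k] children. The 2 is the choice of the subtree receiving an only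
    child; for [k = 0] the truncated predecessor gives [catalan 0 = 1]. *)
Definition node_weight (k : nat) : nat := if k == 1 then 2 else catalan k.-1.

Fixpoint tree_weight (t : tree) : nat :=
  let: Node ts := t in node_weight (size ts) * foldr (fun t c => tree_weight t * c) 1 ts.

Lemma tree_weightE ts :
  tree_weight (Node ts) = node_weight (size ts) * \prod_(t <- ts) tree_weight t.
Proof. by rewrite /= unlock /reducebig; congr (_ * _); elim: ts => //= t ts ->. Qed.

Lemma tree_weight_prod t M : nverts t <= M ->
  tree_weight t = \prod_(i < M) node_weight i ^ degcount t i.
Proof.
elim/tree_children_ind: t => ts IH; rewrite nvertsE tree_weightE => lt_M.
have size_le : size ts <= \sum_(t <- ts) nverts t.
  by rewrite -sum1_size; apply: leq_sum => t _; apply: nverts_gt0.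
have -> : \prod_(t <- ts) tree_weight t =
    \prod_(t <- ts) \prod_(i < M) node_weight i ^ degcount t i.
  rewrite big_seq [RHS]big_seq; apply: eq_bigr => t t_in; apply: IH => //.
  by apply: leq_trans (ltnW lt_M); rewrite (big_rem t) //= leq_addr.
rewrite exchange_big /= [RHS](eq_bigr (fun i : 'I_M => node_weight i ^ (size ts == i)
    * \prod_(t <- ts) node_weight i ^ degcount t i)); last first.
  by move=> i _; rewrite degcountE expnD expn_sum.
rewrite big_split /=; congr (_ * _).
rewrite (bigD1 (Ordinal (leq_ltn_trans size_le lt_M))) //= eqxx expn1 big1 ?muln1 // => i.
by rewrite -val_eqE /= eq_sym => /negPf->.
Qed.

Lemma tree_weight_rhs S (m := nverts S) :
  tree_weight S =
  2 ^ degcount S 1 * \prod_(3 <= i < m) catalan i.-1 ^ degcount S i.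
Proof.
(* The bound [m.+3] lets the factors of degrees 0, 1, 2 be split off even for small [m]; degrees
   from [m] on contribute 1. *)
rewrite (@tree_weight_prod S m.+3) -?[m.+3]addn3 ?leq_addr // addn3.
rewrite !big_ord_recl /= -[node_weight 0]/1 -[node_weight (bump 0 0)]/2.
rewrite -[node_weight (bump 0 (bump 0 0))]/1 !exp1n !mul1n; congr (_ * _).
rewrite (big_nat_widen _ _ m.+3) ?leqW // big_add1 big_add1 big_add1 /= big_mkord [RHS]big_mkcond /=.
apply: eq_bigr => i _; case: ltnP => // /degcount_large ->; exact: expn0.
Qed.

(** Relates the exponents of the children, each with its truncated [- 1], to those of the whole
    tree. *)
Lemma sum_predn (I : Type) (r : seq I) (f : I -> nat) :
  (forall i, 0 < f i) -> \sum_(i <- r) f i = \sum_(i <- r) (f i - 1) + size r.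
Proof.
move=> f_gt0; rewrite -sum1_size -big_split; apply: eq_bigr => i _ /=.
by rewrite subnK.
Qed.

Lemma split_series_nil : split_series [::] = smul Bser Bser.
Proof.
apply: functional_extensionality => n.
by rewrite /split_series big_ord_recl big_ord0 addn0 emb_series_nil.
Qed.

Lemma split_series1 t : split_series [:: t] = sscale 2 (smul Bser (emb_series [:: t])).
Proof.
rewrite split_series_cons; have -> : inner_series [:: t] = szero; last by rewrite sadd0.
by apply: functional_extensionality => n; rewrite /inner_series big_ord0.
Qed.

Lemma smul_split_series gs : 1 < size gs -> smul sX (split_series gs) = emb_series gs.
Proof.
case: gs => [|t [|t' ts]] // _; rewrite [RHS]emb_series_eq.
have -> : ([:: t, t' & ts] == [::]) + ([:: t, t' & ts] == [:: Node [::]]) = 0.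
  by apply/eqP; rewrite addn_eq0 !eqb0; apply/andP; split; apply/eqP.
have -> : sscale 0 sX = szero by [].
by case: t => gs; ring.
Qed.

(** The series [rhs] with its coefficient in the recursive form [tree_weight]. *)
Definition tree_series (S : tree) : series :=
  sscale (tree_weight S)
    (smul (spow (sgeom twoXB) (nverts S + degcount S 0 - 1))
      (smul (spow sX (degcount S 0 + degcount S 1 - 1))
        (spow Bser (degcount S 0 + degcount S 1)))).

Lemma treeprodE ts : (forall t, t \in ts -> emb_series [:: t] = tree_series t) ->
  treeprod ts =
  sscale (\prod_(t <- ts) tree_weight t)
    (smul (spow (sgeom twoXB) (\sum_(t <- ts) (nverts t + degcount t 0 - 1)))
      (smul (spow sX (\sum_(t <- ts) (degcount t 0 + degcount t 1 - 1)))
        (spow Bser (\sum_(t <- ts) (degcount t 0 + degcount t 1))))).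
Proof.
elim: ts => [|t ts IH] emb_ts; first by rewrite !big_nil sscale1 !smul1.
rewrite !big_cons emb_ts ?mem_head // IH => [|t' t'_in]; last first.
  by apply: emb_ts; rewrite inE t'_in orbT.
rewrite sscale_mull sscale_mulr -sscaleM !spowD; congr sscale; ring.
Qed.

Lemma emb_seriesE S : emb_series [:: S] = tree_series S.
Proof.
elim/tree_children_ind: S => gs IH; rewrite emb_series_tree.
have prod_gs := treeprodE IH.
have sumD := @sum_predn _ gs (fun t => nverts t + degcount t 0)
  (fun t => ltn_addr _ (nverts_gt0 t)).
have sumX := @sum_predn _ gs (fun t => degcount t 0 + degcount t 1)
  (fun t => ltn_addr _ (degcount0_gt0 t)).
rewrite /tree_series tree_weightE !degcountE nvertsE.
move: prod_gs sumD sumX; rewrite !big_split /=.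
set sm := \sum_(t <- gs) nverts t; set sl := \sum_(t <- gs) degcount t 0.
set su := \sum_(t <- gs) degcount t 1.
set eD := \sum_(t <- gs) (nverts t + _ - 1); set eX := \sum_(t <- gs) (degcount t 0 + _ - 1).
move=> prod_gs sumD sumX.
have [gs0|gs_gt0] := posnP (size gs).
  move: sumD sumX prod_gs; rewrite /eD /eX /sm /sl /su (size0nil gs0) !big_nil /= => _ _ _.
  (* For a leaf, [z + z B^2] folds back into [B]. *)
  rewrite split_series_nil -[node_weight 0]/1 muln1 !sscale1 -Bser_fix; ring.
have -> : (gs == [::]) = false by case: gs gs_gt0 {IH sm sl su eD eX prod_gs sumD sumX}.
clearbody sm sl su eD eX; have -> : sscale false sX = szero by [].
rewrite sadd0.
(* A unary root adds one factor each of [D], [z] and [B], and the weight 2. *)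
have [gs1|gs_neq1] := eqVneq (size gs) 1.
  have [t def_gs] : exists t, gs = [:: t] by case: (gs) gs1 => [|t []] // _; exists t.
  have -> : split_series gs = sscale 2 (smul Bser (treeprod gs)).
    by rewrite def_gs split_series1 big_seq1.
  rewrite prod_gs; rewrite gs1 in sumD sumX.
  have -> : sm.+1 + (false + sl) - 1 = eD.+1 by lia.
  have -> : false + sl + (true + su) - 1 = eX.+1 by lia.
  have -> : false + sl + (true + su) = (sl + su).+1 by lia.
  rewrite gs1 !spowS /node_weight /= !sscale_mulr -sscaleM.
  congr sscale; ring.
have gs_ge2 : 1 < size gs by lia.
(* With [k >= 2] children the forest formula gives [(zD)^(k-1)], and the root adds one more [D]. *)
rewrite smul_split_series // emb_series_forest // prod_gs spowM.
have -> : sm.+1 + (false + sl) - 1 = ((size gs).-1 + eD).+1 by lia.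
have -> : false + sl + (false + su) - 1 = (size gs).-1 + eX by lia.
have -> : false + sl + (false + su) = sl + su by lia.
rewrite spowS !spowD /node_weight (negPf gs_neq1) !sscale_mulr -sscaleM.
congr sscale; ring.
Qed.

(* For every n and every duplicate-free list L enumerating exactly B_n,
   the total number of embeddings of S into the trees of B_n equals the
   n-th coefficient of the series on the right-hand side. *)
Theorem theorem1 (S : tree) (n : nat) (L : seq tree) :
  1 <= nverts S ->
  List.NoDup L ->
  (forall T, List.In T L <-> (is_binary T /\ nverts T = n)) ->
  sumn [seq a_T T S | T <- L] = rhs S n.
Proof.
move=> _ uL memL; rewrite (sum_aT_series S uL memL) emb_seriesE.
by rewrite /tree_series tree_weight_rhs.
Qed.
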